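(* Let $(I,C)$ be a hypergraph (finite set of agents $I$, finite set of contracts $C$, each contract $c$ with nonempty participant set $P(c)\subseteq I$, parallel contracts allowed) equipped with Plott choice functions $f_i$ on $C(i)$, $i\in I$. Then there exist a hypergraph $(I',C')$ equipped with weak orders and a hypergraph homomorphism $\pi:(I',C')\to(I,C)$ such that: (a) for every stable system $S'\subseteq C'$, its image $\pi(S')$ is a stable system in $C$; (b) for every stable system $S\subseteq C$ there is a stable system $S'\subseteq C'$ with $\pi(S')=S$.
   Context: For $S\subseteq C$ and $i\in I$, $S(i)=\{s\in S: i\in P(s)\}$; an equipment of $(I,C)$ assigns to each agent $i$ a choice function $f_i$ on $C(i)$. A choice function on a finite set $X$ is a map $f:2^X\to2^X$ with $f(A)\subseteq A$; it is a Plott function if $f(A\cup B)=f(f(A)\cup B)$ for all $A,B\subseteq X$. An equipment by weak orders means each agent $i$ has a weak order (complete preorder) $\le_i$ on $C(i)$ and $f_i(A)$ is the set of $\le_i$-maximal elements of $A$. A hypergraph homomorphism $\pi$ maps agents to agents and contracts to contracts so that $P(\pi(c'))=\pi(P(c'))$ for each $c'\in C'$. A system $S\subseteq C$ is stable if (S0) $f_i(S(i))=S(i)$ for all $i\in I$, and (S* ) for every $b\in C\setminus S$ there is $i\in P(b)$ with $b\notin f_i(S(i)\cup\{b\})$. *)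

(* Defs.v *)
From HB Require Import structures.
From mathcomp Require Import all_boot.

Set Implicit Arguments.
Unset Strict Implicit.
Unset Printing Implicit Defensive.

(* Parallel contracts are allowed: [participants] need not be injective. *)
Record hypergraph : Type := Hypergraph {
  agent : finType;
  contract : finType;
  participants : contract -> {set agent};
  participants_neq0 : forall c, participants c != set0
}.

Definition contracts_of (H : hypergraph) (S : {set contract H}) (i : agent H) :
  {set contract H} := [set s in S | i \in participants s].

(* A choice function on a subset X of T is represented by a map on all of
   {set T}; only its values on the subsets of X are constrained, and only
   those values are used below. *)
Definition choice_function_on (T : finType) (X : {set T})
    (f : {set T} -> {set T}) : Prop :=
  forall A : {set T}, A \subset X -> f A \subset A.

Definition plott_function_on (T : finType) (X : {set T})
    (f : {set T} -> {set T}) : Prop :=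
  choice_function_on X f /\
  forall A B : {set T}, A \subset X -> B \subset X ->
    f (A :|: B) = f (f A :|: B).

(* [r a b] reads "a is at most b"; totality includes reflexivity. *)
Definition weak_order_on (T : finType) (X : {set T}) (r : rel T) : Prop :=
  {in X &, total r} /\ {in X & &, transitive r}.

Definition maximal_elements (T : finType) (r : rel T) (A : {set T}) : {set T} :=
  [set a in A | ~~ [exists b in A, r a b && ~~ r b a]].

Definition equipment (H : hypergraph) : Type :=
  agent H -> {set contract H} -> {set contract H}.

Definition plott_equipment (H : hypergraph) (f : equipment H) : Prop :=
  forall i : agent H, plott_function_on (contracts_of [set: contract H] i) (f i).

Definition weak_order_equipment (H : hypergraph)
    (r : agent H -> rel (contract H)) (f : equipment H) : Prop :=
  forall i : agent H,
    weak_order_on (contracts_of [set: contract H] i) (r i) /\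
    forall A : {set contract H},
      A \subset contracts_of [set: contract H] i ->
      f i A = maximal_elements (r i) A.

Definition equipped_with_weak_orders (H : hypergraph) (f : equipment H) : Prop :=
  exists r : agent H -> rel (contract H), weak_order_equipment r f.

Definition stable (H : hypergraph) (f : equipment H) (S : {set contract H}) :
    Prop :=
  (forall i : agent H, f i (contracts_of S i) = contracts_of S i) /\
  (forall b : contract H, b \notin S ->
     exists2 i : agent H, i \in participants b &
       b \notin f i (b |: contracts_of S i)).

Record hypergraph_hom (H' H : hypergraph) : Type := HypergraphHom {
  hom_agent : agent H' -> agent H;
  hom_contract : contract H' -> contract H;
  hom_participants : forall c' : contract H',
    participants (hom_contract c') = hom_agent @: participants c'
}.

(* Main.v *)
Require Import Defs.
From HB Require Import structures.
From mathcomp Require Import all_boot.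

Set Implicit Arguments.
Unset Strict Implicit.
Unset Printing Implicit Defensive.

(** By the Aizerman-Malishevski theorem, a Plott function [f] that keeps every
    singleton is a union of maximizers of weak orders: [a] is in [f A] iff
    [a] is a best element of [A] for some weak order whose best elements
    are always chosen by [f]. Split every agent into one clone per such order,
    and every contract [c] into one copy per selection of a clone for each
    participant of [c]; a clone compares copies through the contracts they come
    from, so that copies of the same contract are tied. In a stable system
    upstairs a clone accepts any copy of a contract it already has, hence every
    clone of [i] holds the best contract of the projection of the system at [i];
    conversely a stable system is lifted to all the copies at which every
    participating clone gets its best contract. Contracts that some participant
    rejects as singletons are in no stable system and get no copy. *)

(** * Rankings that rationalize a Plott function *)

Section PlottRankings.

Variable T : finType.
Implicit Types (A B D X : {set T}) (f : {set T} -> {set T}) (k : T -> nat).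

(** Path independence gives [f B = f (f A :|: (B :\: A))], and an [x] of [A] chosen there can only
    come from [f A]. *)
Lemma plott_sub X f A B x : plott_function_on X f -> B \subset X ->
  A \subset B -> x \in A -> x \in f B -> x \in f A.
Proof.
move=> [fsub fP] sBX sAB xA.
have sAX := subset_trans sAB sBX.
have -> : B = A :|: (B :\: A) by rewrite -{1}(setIidPr sAB) setID.
have sDX : B :\: A \subset X by apply: subset_trans sBX; apply: subsetDl.
rewrite fP // => xf.
have /fsub/subsetP/(_ _ xf) : f A :|: (B :\: A) \subset X.
  by rewrite subUset sDX andbT (subset_trans (fsub _ sAX)).
by rewrite !inE xA /= orbF.
Qed.

(** Any ranking has a best element on each singleton, so only these elements can be ranked
    consistently with [f]. *)
Definition singly_chosen X f : {set T} := [set x in X | x \in f [set x]].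

Lemma singly_chosen_sub X f : singly_chosen X f \subset X.
Proof. by apply/subsetP => x; rewrite inE => /andP[]. Qed.

Lemma fixed_singly_chosen X f A : plott_function_on X f -> A \subset X ->
  f A = A -> A \subset singly_chosen X f.
Proof.
move=> fP sAX fA; apply/subsetP => x xA; rewrite inE (subsetP sAX) //=.
by apply: (plott_sub fP sAX); rewrite ?sub1set ?set11 ?fA.
Qed.

(** Were [f B] empty, path independence with [[set x]] would give [f B = f [set x]], which contains
    [x]. *)
Lemma plott_nonempty X f B : plott_function_on X f ->
  B \subset singly_chosen X f -> B != set0 -> f B != set0.
Proof.
move=> fP sB /set0Pn[x xB]; apply/eqP => fB0.
have sBX := subset_trans sB (singly_chosen_sub X f).
have /andP[xX] : (x \in X) && (x \in f [set x]).
  by have := subsetP sB _ xB; rewrite inE.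
have := fP.2 B [set x] sBX; rewrite sub1set => /(_ xX).
by rewrite (setUidPl _) ?sub1set // fB0 set0U => <-; rewrite inE.
Qed.

Definition is_best k A a := (a \in A) && [forall b in A, k a <= k b].

Lemma is_bestP k A a :
  reflect (a \in A /\ forall b, b \in A -> k a <= k b) (is_best k A a).
Proof.
by apply: (iffP andP) => -[aA /forall_inP].
Qed.

Lemma ex_best k A : A != set0 -> exists a, is_best k A a.
Proof.
move=> /set0Pn[x xA]; case: (arg_minnP k xA) => a aA amin.
by exists a; apply/is_bestP.
Qed.

(* Small ranks are good; ties are allowed, and outside [X] the ranking is
   irrelevant. *)
Definition rationalizes f X k :=
  [forall A : {set T}, (A \subset X) ==>
     [forall a, is_best k A a ==> (a \in f A)]].

Lemma rationalizesP f X k :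
  reflect (forall A a, A \subset X -> is_best k A a -> a \in f A)
          (rationalizes f X k).
Proof.
apply: (iffP forallP) => [best_k A a sAX|best_k A].
  by have /implyP/(_ sAX)/forallP/(_ a)/implyP := best_k A.
apply/implyP => sAX; apply/forallP => a.
by apply/implyP; apply: best_k.
Qed.

(** A chosen [x] can safely go on top: it is the sole best element of any [A] containing it, and
    [plott_sub] keeps it chosen there; on other sets the ranks are merely shifted. *)
Lemma rationalizes_extend X f B x k : plott_function_on X f -> B \subset X ->
  x \in f B -> rationalizes f (B :\ x) k ->
  {in B :\ x, forall c, k c < #|B :\ x|} ->
  let k' := fun c => if c == x then 0 else (k c).+1 in
  rationalizes f B k' /\ {in B, forall c, k' c < #|B|}.
Proof.
move=> fP sBX xfB /rationalizesP best_k k_lt; split; last first.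
  have xB := subsetP (fP.1 _ sBX) _ xfB.
  move=> c cB; rewrite (cardsD1 x B) xB add1n; case: eqVneq => // cx.
  by rewrite ltnS k_lt // !inE cx.
apply/rationalizesP => A a sAB /is_bestP[aA].
case: (boolP (x \in A)) => [xA|xA] amin.
  have := amin x xA; rewrite eqxx; case: eqVneq => // -> _.
  exact: plott_sub fP sBX sAB xA xfB.
have nx b : b \in A -> b != x by apply: contraTneq => ->.
apply: best_k; first by rewrite subsetD1 sAB.
by apply/is_bestP; split=> // b bA; have := amin b bA; rewrite !ifN ?nx.
Qed.

(** Greedy ranking: [plott_nonempty] always supplies a chosen element to rank next. *)
Lemma ranking_exists X f B : plott_function_on X f ->
  B \subset singly_chosen X f ->
  exists2 k, rationalizes f B k & {in B, forall c, k c < #|B|}.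
Proof.
move=> fP; have [n] := ubnP #|B|; elim: n B => // n IHn B Bn sB.
have sBX := subset_trans sB (singly_chosen_sub X f).
have [->|B_neq0] := eqVneq B set0.
  exists (fun=> 0); last by move=> c; rewrite inE.
  apply/rationalizesP => A a.
  by rewrite subset0 => /eqP-> /is_bestP[]; rewrite inE.
have /set0Pn[x xfB] := plott_nonempty fP sB B_neq0.
have xB := subsetP (fP.1 _ sBX) _ xfB.
have [||k kr k_lt] := IHn (B :\ x).
- by move: Bn; rewrite (cardsD1 x B) xB.
- by apply: subset_trans sB; apply: subD1set.
have [] := rationalizes_extend fP sBX xfB kr k_lt.
by exists (fun c => if c == x then 0 else (k c).+1).
Qed.

(* Rank first, as long as possible, chosen elements outside [A]; once all
   chosen elements of the remaining set [B] lie in [A], path independence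
   gives [f B = f A], so [a] can be ranked next. *)
Lemma ranking_with_best X f A B a : plott_function_on X f ->
  B \subset singly_chosen X f -> A \subset B -> a \in f A ->
  exists k, [/\ rationalizes f B k, {in B, forall c, k c < #|B|} &
                is_best k A a].
Proof.
move=> fP; have [n] := ubnP #|B|; elim: n B => // n IHn B Bn sB sAB afA.
have sBX := subset_trans sB (singly_chosen_sub X f).
have sAX := subset_trans sAB sBX.
have aA := subsetP (fP.1 _ sAX) _ afA.
have sB1 x : B :\ x \subset singly_chosen X f.
  by apply: subset_trans sB; apply: subD1set.
have [sfA|/subsetPn[x xfB xA]] := boolP (f B \subset A).
  have afB : a \in f B.
    by rewrite -(setUidPl sAB) fP.2 // (setUidPr sfA).
  have [k kr k_lt] := ranking_exists fP (sB1 a).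
  have [kr' k_lt'] := rationalizes_extend fP sBX afB kr k_lt.
  exists (fun c => if c == a then 0 else (k c).+1); split=> //.
  by apply/is_bestP; split=> // b _; rewrite eqxx.
have xB := subsetP (fP.1 _ sBX) _ xfB.
have [||||k [kr k_lt /is_bestP[_ ka]]] := IHn (B :\ x) => //.
- by move: Bn; rewrite (cardsD1 x B) xB.
- by rewrite subsetD1 sAB.
have [kr' k_lt'] := rationalizes_extend fP sBX xfB kr k_lt.
exists (fun c => if c == x then 0 else (k c).+1); split=> //.
have nx b : b \in A -> b != x by apply: contraTneq => ->.
by apply/is_bestP; split=> // b bA; rewrite !ifN ?nx // ltnS ka.
Qed.

(** Bounded ranks keep the agents and contracts upstairs finite; the successor makes the ordinal
    type inhabited even for empty [T]. *)
Definition ranking : finType := {ffun T -> 'I_#|T|.+1}.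
Definition rank_of (k : ranking) (x : T) : nat := k x.

Lemma eq_in_is_best k k' A a : {in A, k =1 k'} ->
  is_best k A a = is_best k' A a.
Proof.
move=> ekk'; apply/is_bestP/is_bestP => -[aA amin]; split=> // b bA.
  by rewrite -!ekk' ?amin.
by rewrite !ekk' ?amin.
Qed.

Lemma plott_best_ranking X f A a : plott_function_on X f ->
  A \subset singly_chosen X f -> a \in f A ->
  exists2 k : ranking, rationalizes f (singly_chosen X f) (rank_of k) &
                       is_best (rank_of k) A a.
Proof.
move=> fP sA afA.
have [k [/rationalizesP best_k k_lt ka]] :=
  ranking_with_best fP (subxx _) sA afA.
(* By [k_lt], [inord] alters no rank on the singly chosen elements. *)
pose k' : ranking := [ffun x => inord (k x)].
have kk' : {in singly_chosen X f, k =1 rank_of k'}.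
  move=> x xX; rewrite /rank_of ffunE inordK //.
  by rewrite ltnS ltnW // (leq_trans (k_lt _ xX)) ?max_card.
exists k'.
  apply/rationalizesP => B b sB; rewrite -(@eq_in_is_best k).
    exact: best_k.
  by move=> x /(subsetP sB)/kk'.
by rewrite -(@eq_in_is_best k) // => x /(subsetP sA)/kk'.
Qed.

End PlottRankings.

(** * The hypergraph of clones and copies *)

Section CloneHypergraph.

Variables (H : hypergraph) (f : equipment H).
Hypothesis f_plott : plott_equipment f.

Local Notation C := (contract H).
Local Notation clone_choice := {ffun agent H -> ranking C}.

Definition acceptable (i : agent H) : {set C} :=
  singly_chosen (contracts_of [set: C] i) (f i).

(** The selection [p.2] is free at nonparticipants, which only multiplies parallel copies. *)
Definition admissible (p : C * clone_choice) :=
  [forall i in participants p.1, (p.1 \in acceptable i) &&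
     rationalizes (f i) (acceptable i) (rank_of (p.2 i))].

Definition copy : finType := {p : C * clone_choice | admissible p}.

Definition base (u : copy) : C := (val u).1.
Definition clone (u : copy) : clone_choice := (val u).2.

Definition copy_participants (u : copy) : {set agent H * ranking C} :=
  [set (i, clone u i) | i in participants (base u)].

Lemma copy_participants_neq0 u : copy_participants u != set0.
Proof.
have /set0Pn[i iP] := participants_neq0 (base u).
by apply/set0Pn; exists (i, clone u i); apply: imset_f.
Qed.

Definition clone_hypergraph : hypergraph :=
  Hypergraph copy_participants_neq0.

Lemma base_participants (u : contract clone_hypergraph) :
  participants (base u) = fst @: participants u.
Proof.
rewrite /= /copy_participants -imset_comp.
by rewrite (eq_imset (g := id)) ?imset_id.
Qed.

Definition clone_hom : hypergraph_hom clone_hypergraph H :=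
  HypergraphHom base_participants.

(** The comparison is reversed because small ranks are good. *)
Definition clone_order (j : agent clone_hypergraph) :
    rel (contract clone_hypergraph) :=
  fun u v => rank_of j.2 (base v) <= rank_of j.2 (base u).

Definition clone_equipment : equipment clone_hypergraph :=
  fun j => maximal_elements (clone_order j).

Lemma clone_weak_orders : equipped_with_weak_orders clone_equipment.
Proof.
exists clone_order => j; split=> //; split.
  by move=> u v _ _; apply: leq_total.
by move=> v u w _ _ _ uv vw; apply: leq_trans vw uv.
Qed.

Lemma mem_clone_equipment j (A : {set copy}) u :
  reflect (u \in A /\ forall v, v \in A ->
             rank_of j.2 (base u) <= rank_of j.2 (base v))
          (u \in clone_equipment j A).
Proof.
rewrite inE; apply: (iffP andP) => -[uA ubest]; split=> //.
  move=> v vA; rewrite leqNgt; apply: contra ubest => lt_vu.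
  by apply/exists_inP; exists v => //; rewrite /clone_order -ltnNge lt_vu ltnW.
apply/exists_inPn => v vA.
by rewrite /clone_order negb_and negbK (ubest v vA) orbT.
Qed.

Lemma mem_copy_contracts (S' : {set copy}) i k u :
  (u \in contracts_of (H := clone_hypergraph) S' (i, k)) =
  [&& u \in S', i \in participants (base u) & clone u i == k].
Proof.
rewrite inE; congr (_ && _); apply/imsetP/andP => [[j jP [-> ->]]|[iP /eqP<-]].
  by rewrite eqxx.
by exists i.
Qed.

Lemma copyP (u : copy) i : i \in participants (base u) ->
  base u \in acceptable i /\
  rationalizes (f i) (acceptable i) (rank_of (clone u i)).
Proof.
by move=> iP; have /forall_inP/(_ i iP)/andP := valP u.
Qed.

(** Finite choice assembles rankings found separately for each participant into one copy;
    nonparticipants get an arbitrary ranking. *)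
Lemma ex_copy (c : C) (Q : agent H -> ranking C -> Prop) :
  (forall i, i \in participants c -> c \in acceptable i /\
     exists2 k, rationalizes (f i) (acceptable i) (rank_of k) & Q i k) ->
  exists2 u : copy, base u = c &
    forall i, i \in participants c -> Q i (clone u i).
Proof.
move=> cQ.
have /fin_all_exists[s sP] : forall i, exists k, i \in participants c ->
    rationalizes (f i) (acceptable i) (rank_of k) /\ Q i k.
  move=> i; have [/cQ[_ [k kr kQ]]|_] := boolP (i \in participants c).
    by exists k.
  by exists [ffun=> ord0].
have adm : admissible (c, finfun s).
  apply/forall_inP => i /= iP; rewrite ffunE.
  by have [-> _] := cQ i iP; have [-> _] := sP i iP.
exists (exist _ (c, finfun s) adm) => //= i iP.
by rewrite /clone /= ffunE; have [] := sP i iP.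
Qed.

Lemma contracts_of_sub (S : {set C}) i :
  contracts_of S i \subset contracts_of [set: C] i.
Proof. by apply/subsetP => c; rewrite !inE => /andP[_ ->]. Qed.

Lemma contracts_of_participant (S : {set C}) c i : c \in S ->
  i \in participants c -> c \in contracts_of S i.
Proof. by move=> cS iP; rewrite inE cS. Qed.

(** * Projecting stable systems *)

Section Projection.

Variable S' : {set copy}.
Hypothesis S'_stable : stable clone_equipment S'.

Local Notation S := (base @: S').

Lemma projection_acceptable i : contracts_of S i \subset acceptable i.
Proof.
apply/subsetP => c; rewrite inE => /andP[/imsetP[u _ ->]] /copyP[] //.
Qed.

(* Otherwise the copy of [c] in [S'], moved to the clone [k] of [i], would
   block: all its other participants hold a copy of [c] already. *)
Lemma clone_holds_better i k c : c \in contracts_of S i ->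
  rationalizes (f i) (acceptable i) (rank_of k) ->
  exists2 u, u \in contracts_of (H := clone_hypergraph) S' (i, k) &
             rank_of k (base u) <= rank_of k c.
Proof.
rewrite inE => /andP[/imsetP[v vS' ->{c}] iP] kr.
have [|w wv wQ] := @ex_copy (base v)
    (fun j l => l = if j == i then k else clone v j).
  move=> j jP; have [ja jr] := copyP jP; split=> //.
  by exists (if j == i then k else clone v j) => //; case: eqP => [->|].
have wi : clone w i = k by rewrite wQ // eqxx.
have [wS'|wS'] := boolP (w \in S').
  by exists w; rewrite ?wv // mem_copy_contracts wS' wv iP wi /=.
have [[j l]] := S'_stable.2 w wS'.
case/imsetP=> j' jP [-> ->]; rewrite wv in jP => wnot.
have /exists_inP[u] : [exists u in contracts_of (H := clone_hypergraph) S'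
      (j', clone w j'), rank_of (clone w j') (base u) <
                        rank_of (clone w j') (base w)].
  apply: contraR wnot => /exists_inPn no_u; apply/mem_clone_equipment.
  split; first exact: setU11.
  by move=> u /setU1P[-> //|/no_u]; rewrite -leqNgt.
have [eji|ji] := eqVneq j' i.
  by rewrite eji wi wv => uS' /ltnW; exists u.
(* Here [v] and [w] are tied, so the clone of [j'] holding [v] would also hold the strictly better
   [u], against (S0). *)
have ev : clone w j' = clone v j' by rewrite wQ // (negPf ji).
rewrite ev wv => uS'.
have vS'j : v \in contracts_of (H := clone_hypergraph) S' (j', clone v j').
  by rewrite mem_copy_contracts vS' jP /=.
have := vS'j; rewrite -(S'_stable.1 _) => /mem_clone_equipment[_ /(_ u uS')] /=.
by rewrite leqNgt => /negbTE->.
Qed.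

(** For (S0), a copy held by a clone is best among its holdings, hence by [clone_holds_better] among
    all of the projection at [i], so [f i] chooses its base. *)
Lemma projection_stable : stable f S.
Proof.
split=> [i|b bS].
  apply/eqP; rewrite eqEsubset (f_plott i).1 ?contracts_of_sub //=.
  apply/subsetP => c; rewrite inE => /andP[/imsetP[u uS' ->{c}] iP].
  have [_ ur] := copyP iP.
  have /rationalizesP best := ur.
  apply: best (projection_acceptable i) _; apply/is_bestP; split.
    by apply: contracts_of_participant => //; apply: imset_f.
  move=> c cS; have [w wS'] := clone_holds_better cS ur.
  apply: leq_trans.
  have : u \in contracts_of (H := clone_hypergraph) S' (i, clone u i).
    by rewrite mem_copy_contracts uS' iP /=.
  rewrite -(S'_stable.1 _) => /mem_clone_equipment[_] /(_ w); exact.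
have [/exists_inP[i iP bi]|/exists_inPn all_b] :=
  boolP [exists i in participants b, b \notin f i (b |: contracts_of S i)].
  by exists i.
have sub_b i : i \in participants b ->
    b |: contracts_of S i \subset contracts_of [set: C] i.
  by move=> iP; rewrite subUset contracts_of_sub sub1set !inE iP.
have bacc i : i \in participants b -> b \in acceptable i.
  move=> iP; rewrite inE (subsetP (sub_b i iP)) ?setU11 //=.
  apply: (plott_sub (f_plott i) (sub_b i iP)); rewrite ?set11 //.
    by rewrite sub1set setU11.
  by have := all_b i iP; rewrite negbK.
(* If no participant refuses [b], each has a clone ranking [b] best, and the copy of [b] at these
   clones would block [S']. *)
have [|w wb wQ] := @ex_copy b
    (fun i k => is_best (rank_of k) (b |: contracts_of S i) b).
  move=> i iP; split; first exact: bacc.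
  apply: (plott_best_ranking (f_plott i)).
    by rewrite subUset sub1set bacc ?projection_acceptable.
  by have := all_b i iP; rewrite negbK.
have wS' : w \notin S' by apply: contra bS => wS'; rewrite -wb imset_f.
have [j jP] := S'_stable.2 w wS'; case/imsetP: jP => i; rewrite wb => iP ->.
case/mem_clone_equipment; split; first exact: setU11.
have /is_bestP[_ wbest] := wQ i iP.
move=> v /setU1P[-> //|]; rewrite mem_copy_contracts /= wb.
case/and3P=> vS' viP _; apply: wbest.
by rewrite setU1r // contracts_of_participant // imset_f.
Qed.

End Projection.

(** * Lifting stable systems *)

Section Lifting.

Variable S : {set C}.
Hypothesis S_stable : stable f S.

Definition lifting : {set copy} :=
  [set u : copy | (base u \in S) && [forall i in participants (base u),
     is_best (rank_of (clone u i)) (contracts_of S i) (base u)]].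

Lemma stable_acceptable i : contracts_of S i \subset acceptable i.
Proof.
exact: fixed_singly_chosen (f_plott i) (contracts_of_sub S i) (S_stable.1 i).
Qed.

(** Clones are prescribed on [P] and supplied by [plott_best_ranking] elsewhere. An empty [P] yields
    surjectivity onto [S]; a singleton hands a contract to a given clone. *)
Lemma best_copy_in_lifting c (P : pred (agent H)) (s : agent H -> ranking C) :
  c \in S ->
  (forall i, i \in participants c -> P i ->
     rationalizes (f i) (acceptable i) (rank_of (s i)) /\
     is_best (rank_of (s i)) (contracts_of S i) c) ->
  exists2 u, u \in lifting &
    base u = c /\ forall i, i \in participants c -> P i -> clone u i = s i.
Proof.
move=> cS sP.
have [|u uc uQ] := @ex_copy c (fun i k =>
    is_best (rank_of k) (contracts_of S i) c /\ (P i -> k = s i)).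
  move=> i iP; have cSi := contracts_of_participant cS iP.
  split; first exact: (subsetP (stable_acceptable i)).
  have [Pi|nPi] := boolP (P i); first by have [] := sP i iP Pi; exists (s i).
  have [|k kr kb] := plott_best_ranking (f_plott i) (stable_acceptable i)
                        (a := c); last by exists k.
  by rewrite S_stable.1.
exists u; last by split=> // i iP Pi; have [_ ->] := uQ i iP.
rewrite inE uc cS /=; apply/forall_inP => i iP.
by have [] := uQ i iP.
Qed.

Lemma base_lifting : base @: lifting = S.
Proof.
apply/setP => c; apply/imsetP/idP => [[u]|cS].
  by rewrite inE => /andP[uS _] ->.
have [//|u uL [uc _]] :=
  @best_copy_in_lifting c pred0 (fun=> [ffun=> ord0]) cS.
by exists u.
Qed.

(** (S0) holds because everything a clone holds in the lifting is tied at its best rank. *)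
Lemma lifting_stable : stable clone_equipment lifting.
Proof.
split=> [[i k]|w wL].
  apply/setP => u; apply/mem_clone_equipment/idP => [[] //|uL]; split=> //.
  move=> v; move: uL; rewrite !mem_copy_contracts !inE.
  case/and3P=> /andP[uS /forall_inP ubest] iu /eqP eu.
  case/and3P=> /andP[vS _] iv _.
  have /is_bestP[_] := ubest i iu; rewrite eu; apply.
  exact: contracts_of_participant.
(* Some clone participating in [w] strictly prefers a contract of [S]. *)
suff [i iP [c cS lt_cw]] : exists2 i, i \in participants (base w) &
    exists2 c, c \in contracts_of S i &
      rank_of (clone w i) c < rank_of (clone w i) (base w).
  (* That clone holds a copy of its best contract [d] in the lifting, hence refuses [w]. *)
  have [|d /is_bestP[dS dmin]] :=
      @ex_best _ (rank_of (clone w i)) (contracts_of S i).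
    by apply/set0Pn; exists c.
  have [_ wr] := copyP iP.
  have /andP[dS0 iPd] : (d \in S) && (i \in participants d).
    by move: dS; rewrite inE.
  have [|u uL [ud us]] :=
      @best_copy_in_lifting d (pred1 i) (fun=> clone w i) dS0.
    by move=> j _ /eqP->; split=> //; apply/is_bestP.
  exists (i, clone w i); first exact: imset_f.
  apply/mem_clone_equipment => -[_ /(_ u)] /=.
  rewrite leqNgt ud (leq_ltn_trans (dmin _ cS) lt_cw) => no.
  apply/notF/no; rewrite setU1r // mem_copy_contracts uL ud iPd /=.
  by rewrite us //=.
have [wS|wS] := boolP (base w \in S).
  move: wL; rewrite inE wS /= => /forall_inPn[i iP nbest].
  exists i => //; apply/exists_inP; apply: contraR nbest => /exists_inPn no.
  apply/is_bestP; split; first exact: contracts_of_participant.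
  by move=> c /no; rewrite -leqNgt.
(* If nothing in [S] at [i] beat [base w] for this clone, rationalization would force [f i] to
   choose [base w], contrary to [wf]. *)
have [i iP wf] := S_stable.2 _ wS; exists i => //.
have [wacc /rationalizesP best] := copyP iP.
apply/exists_inP; apply: contraR wf => /exists_inPn no; apply: best.
  by rewrite subUset sub1set wacc stable_acceptable.
apply/is_bestP; split; first exact: setU11.
by move=> c /setU1P[-> //|/no]; rewrite -leqNgt.
Qed.

End Lifting.

End CloneHypergraph.

Theorem theorem3p1 (H : hypergraph) (f : equipment H)
    (f_plott : plott_equipment f) :
  exists (H' : hypergraph) (f' : equipment H') (pi : hypergraph_hom H' H),
    [/\ equipped_with_weak_orders f',
        forall S' : {set contract H'}, stable f' S' ->
          stable f (hom_contract pi @: S')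
      & forall S : {set contract H}, stable f S ->
          exists2 S' : {set contract H'}, stable f' S' &
            hom_contract pi @: S' = S].
Proof.
exists (clone_hypergraph f), (@clone_equipment H f), (clone_hom f); split.
- exact: clone_weak_orders.
- by move=> S'; apply: projection_stable.
- move=> S S_stable; exists (lifting f S); first exact: lifting_stable.
  exact: base_lifting.
Qed.
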